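(* For every positive integer $k$ there exists a set $W_k$ of patterns of length $k$ such that \[\lim_{k\to\infty}\frac{|W_k|}{k!}=1,\] and such that, for every $k$ and every positive integer $n$, the number $V_n(q)$ is the same for all patterns $q\in W_k$.
   Context: A pattern of length $k$ is a permutation $q=q_1q_2\cdots q_k$ of $\{1,\dots,k\}$ written in one-line notation; an $n$-permutation is a permutation $p=p_1p_2\cdots p_n$ of $\{1,\dots,n\}$. The permutation $p$ very tightly contains $q$ if there are integers $0\le i\le n-k$ and $0\le a\le n-k$ such that (i) for all indices $j,r\in\{1,\dots,k\}$, $q_j<q_r$ if and only if $p_{i+j}<p_{i+r}$, and (ii) $\{p_{i+1},\dots,p_{i+k}\}=\{a+1,\dots,a+k\}$. Otherwise $p$ very tightly avoids $q$ (in particular this is the case if $n<k$). $V_n(q)$ denotes the number of $n$-permutations that very tightly avoid $q$. *)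

(* Defs.v *)
From mathcomp Require Import all_boot all_fingroup.

Set Implicit Arguments.
Unset Strict Implicit.
Unset Printing Implicit Defensive.

(* Positions and values are counted from 0: a permutation of {1, ..., n} is
   represented by p : 'S_n, and one_line p m is p_(m+1) - 1 for m < n (the
   default value 0 for m >= n is never used below). *)
Definition one_line (n : nat) (p : 'S_n) (m : nat) : nat :=
  nth 0 [seq val (p x) | x <- enum 'I_n] m.

(* The guard k <= n is needed because n - k is truncated. *)
Definition very_tightly_contains (n k : nat) (p : 'S_n) (q : 'S_k) : bool :=
  (k <= n) &&
  [exists i : 'I_(n - k).+1, exists a : 'I_(n - k).+1,
    [forall j : 'I_k, forall r : 'I_k,
      (q j < q r) == (one_line p (i + j) < one_line p (i + r))] &&
    ([set p x | x : 'I_n & i <= x < i + k] == [set y : 'I_n | a <= y < a + k])].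

Definition very_tightly_avoids (n k : nat) (p : 'S_n) (q : 'S_k) : bool :=
  ~~ very_tightly_contains p q.

Definition V (n k : nat) (q : 'S_k) : nat :=
  #|[set p : 'S_n | very_tightly_avoids p q]|.

(* Main.v *)
Require Import Defs.
From mathcomp Require Import all_boot all_order all_fingroup all_algebra.
From mathcomp Require Import zify.

(** W k consists of the patterns that are indecomposable: cutting the one-line
    notation after s entries, 0 < s < k, never leaves all entries on one side
    smaller than all entries on the other.

    Seen in the plot of p, a very tight copy of q is a k-by-k square of
    positions and values that p restricts to, with q inside.  If two distinct
    copies of the same q share a position, then the value of p there is common
    too, and p restricts to the intersection of the two squares, which is a
    corner of each.  This corner splits q, so copies of an
    indecomposable pattern have pairwise disjoint position blocks
    ([copies_disjoint]).

    Let q and q' be indecomposable and fix a set S of squares.  If the blocks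
    of S overlap, no permutation has copies of q, or of q', at all of S.
    If not, permuting positions inside each block by the permutation that
    transports q to q' maps the permutations with copies of q on S injectively
    to those with copies of q' on S ([leq_card_containing_copies]).  So the
    number of permutations whose set of copies contains S is the same for q
    and q', for every S; by inclusion-exclusion
    ([superset_counts_determine]) so is the number of those with no copy.

    A pattern split at s stabilises the set of the first s positions, up to
    reversing the values, so at most 2 s! (k - s)! patterns split at s.  The
    sum over 0 < s < k is dominated by s = 1 and s = k - 1, and it is at most
    8 (k - 1)! for k >= 3, a proportion 8 / k of all patterns
    ([card_indecomposables]). *)

Set Implicit Arguments.
Unset Strict Implicit.
Unset Printing Implicit Defensive.

(** * Inclusion-exclusion *)

(** Downward induction on T: the points whose value contains T, less those
    whose value strictly contains T. *)
Lemma superset_counts_determine (P C : finType) (f g : P -> {set C}) :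
    (forall S : {set C},
      #|[set p | S \subset f p]| = #|[set p | S \subset g p]|) ->
  forall T, #|[set p | f p == T]| = #|[set p | g p == T]|.
Proof.
move=> eqN.
have split_by_value (h : P -> {set C}) (T : {set C}) :
    #|[set p | T \subset h p]| = #|[set p | h p == T]| +
    \sum_(U : {set C} | (T \subset U) && (U != T)) #|[set p | h p == U]|.
  rewrite -sum1_card (partition_big h (fun U : {set C} => T \subset U)) /=;
    last by move=> p; rewrite inE.
  rewrite (bigD1 T) //=; congr (_ + _); last apply: eq_bigr => U /andP[TU _].
    by rewrite -sum1_card; apply: eq_bigl => p; rewrite !inE;
      case: eqP => [->|]; rewrite ?subxx ?andbF.
  by rewrite -sum1_card; apply: eq_bigl => p; rewrite !inE;
    case: eqP => [->|]; rewrite ?TU ?andbF.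
move=> T; have [m] := ubnP #|~: T|; elim: m T => // m IHm T leTm.
apply/eqP; rewrite -(eqn_add2r (\sum_(U : {set C} | (T \subset U) && (U != T))
  #|[set p | f p == U]|)) -split_by_value eqN split_by_value eqn_add2l.
apply/eqP/esym/eq_bigr => U /andP[TU nUT]; apply: IHm.
rewrite -ltnS; apply: leq_trans leTm; rewrite ltnS proper_card //.
by rewrite properEneq setCS TU (inj_eq (@setC_inj C)) nUT.
Qed.

(** * Very tight copies as translated patterns *)

Lemma one_lineE n (p : 'S_n) (x : 'I_n) : one_line p x = p x.
Proof.
rewrite /one_line (nth_map x) ?size_enum_ord // ?nth_ord_enum //.
Qed.

Lemma one_line_inj n (p : 'S_n) x y :
  x < n -> y < n -> one_line p x = one_line p y -> x = y.
Proof.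
move=> xn yn; rewrite -[x]/(val (Ordinal xn)) -[y]/(val (Ordinal yn)).
by rewrite !one_lineE => /val_inj/perm_inj ->.
Qed.

Lemma card_ord_lt k m : m <= k -> #|[set j : 'I_k | j < m]| = m.
Proof.
move=> mk; have -> : [set j : 'I_k | j < m] = [set widen_ord mk j | j : 'I_m].
  apply/setP=> j; rewrite inE; apply/idP/imsetP => [jm | [i _ ->]] /=.
    by exists (Ordinal jm) => //; apply: val_inj.
  exact: ltn_ord.
rewrite card_imset ?card_ord // => i j /(congr1 val) /= e; exact: val_inj.
Qed.

(** The value of a permutation at j is its rank, so a permutation is
    determined by the order of its values. *)
Lemma perm_rank k (s : 'S_k) j : #|[set r | s r < s j]| = s j.
Proof.
rewrite -(card_imset _ (@perm_inj _ s)).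
rewrite -[RHS](card_ord_lt (ltnW (ltn_ord (s j)))).
apply/eq_card => y; rewrite [RHS]inE; apply/imsetP/idP => [[r]|ysj].
  by rewrite inE => ? ->.
by exists ((s^-1)%g y); rewrite ?inE permKV.
Qed.

(** First position and least value of a potential copy. *)
Definition corner n k : finType := ('I_(n - k).+1 * 'I_(n - k).+1)%type.

Definition copy_at n k (p : 'S_n) (q : 'S_k) (c : corner n k) : bool :=
  [forall j : 'I_k, one_line p (c.1 + j) == c.2 + q j].

Definition copies n k (p : 'S_n) (q : 'S_k) : {set corner n k} :=
  [set c | copy_at p q c].

Lemma corner_bound n k (i : 'I_(n - k).+1) j : k <= n -> j < k -> i + j < n.
Proof. by move: (ltn_ord i); lia. Qed.

(** The offsets p (i + j) - a form a permutation of the same order type as q,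
    hence equal to q by [perm_rank]. *)
Lemma copy_atE n k (p : 'S_n) (q : 'S_k) (i a : 'I_(n - k).+1) : k <= n ->
  copy_at p q (i, a) =
  [forall j : 'I_k, forall r : 'I_k,
      (q j < q r) == (one_line p (i + j) < one_line p (i + r))] &&
  ([set p x | x : 'I_n & i <= x < i + k] == [set y : 'I_n | a <= y < a + k]).
Proof.
move=> kn; pose pos (j : 'I_k) := Ordinal (corner_bound i kn (ltn_ord j)).
have posE (j : 'I_k) : one_line p (i + j) = p (pos j) by rewrite -one_lineE.
apply/forallP/andP => [copy | [/forallP ord /eqP im]].
  have pE j : p (pos j) = a + q j :> nat by rewrite -posE; apply/eqP/copy.
  split.
    by apply/forallP => j; apply/forallP => r; rewrite !posE !pE ltn_add2l.
  apply/eqP/setP => y; rewrite inE; apply/imsetP/andP => [[x] | [ay yak]].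
    rewrite inE => /andP[ix xik] ->.
    have xk : x - i < k by lia.
    have -> : x = pos (Ordinal xk) by apply: val_inj => /=; lia.
    by rewrite pE; move: (ltn_ord (q (Ordinal xk))); lia.
  have yk : y - a < k by lia.
  exists (pos ((q^-1)%g (Ordinal yk))).
    by rewrite inE /= leq_addr ltn_add2l ltn_ord.
  by apply: val_inj; rewrite /= pE permKV /=; lia.
have range j : a <= p (pos j) < a + k.
  have : p (pos j) \in [set p x | x : 'I_n & i <= x < i + k].
    by rewrite imset_f // inE /= leq_addr ltn_add2l ltn_ord.
  by rewrite im inE.
have lt_k j : p (pos j) - a < k by move: (range j); lia.
have offset_inj : injective (fun j => Ordinal (lt_k j)).
  move=> j r /(congr1 val) /= e.
  have /val_inj/perm_inj/(congr1 val)/addnI/val_inj// :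
    p (pos j) = p (pos r) :> nat by move: (range j) (range r); lia.
pose s := perm offset_inj.
have sE j : s j = p (pos j) - a :> nat by rewrite permE.
move=> j; apply/eqP; rewrite posE -(perm_rank q).
have -> : [set r | q r < q j] = [set r | s r < s j].
  apply/setP => r; rewrite !inE.
  have /forallP/(_ j)/eqP -> := ord r.
  by rewrite !posE !sE; move: (range j) (range r); lia.
by rewrite perm_rank sE /=; move: (range j); lia.
Qed.

Lemma very_tightly_avoidsE n k (p : 'S_n) (q : 'S_k) : k <= n ->
  very_tightly_avoids p q = (copies p q == set0).
Proof.
move=> kn; rewrite /very_tightly_avoids /very_tightly_contains kn /=.
apply/negP/eqP => [avoid | none].
  apply/setP => -[i a]; rewrite !inE; apply/negP => copy; apply: avoid.
  by apply/existsP; exists i; apply/existsP; exists a; rewrite -copy_atE.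
case/existsP => i /existsP[a]; rewrite -copy_atE // => copy.
by have := in_set0 (i, a); rewrite -none inE copy.
Qed.

(** * Transporting copies on disjoint blocks *)

Definition in_block n k (c : corner n k) (x : nat) : bool :=
  c.1 <= x < c.1 + k.

Definition disjoint_blocks n k (S : {set corner n k}) : Prop :=
  forall c d x, c \in S -> d \in S -> in_block c x -> in_block d x -> c = d.

Section BlockPerm.
Variables (n k : nat) (S : {set corner n k}).
Hypotheses (kn : k <= n) (disjS : disjoint_blocks S).

Lemma block_index (c : corner n k) x : in_block c x -> x - c.1 < k.
Proof. by rewrite /in_block; lia. Qed.

(** Acts as s inside each block of S and fixes every other position.  The
    inner default branch is never reached: x lies in the block of c. *)
Definition block_move (s : 'S_k) (x : 'I_n) : 'I_n :=
  if [pick c in S | in_block c x] is Some c then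
    if insub (x - c.1) is Some j then
      Ordinal (corner_bound c.1 kn (ltn_ord (s j)))
    else x
  else x.

Lemma block_move_in s c (j : 'I_k) (x : 'I_n) :
  c \in S -> x = c.1 + j :> nat -> block_move s x = c.1 + s j :> nat.
Proof.
move=> cS xE; have cx : in_block c x.
  by rewrite /in_block xE leq_addr ltn_add2l ltn_ord.
rewrite /block_move; case: pickP => [d /andP[dS dx]|/(_ c)]; last first.
  by rewrite cS cx.
have -> : d = c by apply: disjS dx cx.
case: insubP => [j' _ j'E|]; last by rewrite xE addKn ltn_ord.
by have -> : j' = j by apply: val_inj; rewrite /= j'E xE addKn.
Qed.

Lemma block_move_out s (x : 'I_n) :
  (forall c, c \in S -> ~~ in_block c x) -> block_move s x = x.
Proof.
rewrite /block_move => out; case: pickP => // c /andP[cS].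
by rewrite (negPf (out c cS)).
Qed.

Lemma block_moveK s : cancel (block_move s) (block_move s^-1).
Proof.
move=> x; case: (pickP [pred c in S | in_block c x]) => [c /andP[cS cx]|out].
  pose j := Ordinal (block_index cx).
  have xE : x = c.1 + j :> nat by move: (cx); rewrite /in_block /=; lia.
  apply: val_inj; rewrite /= (block_move_in _ cS (block_move_in s cS xE)).
  by rewrite permK.
have fixx t : block_move t x = x.
  by apply: block_move_out => c cS; have /= := out c; rewrite cS => /negbT.
by rewrite !fixx.
Qed.

Definition block_perm s : 'S_n := perm (can_inj (block_moveK s)).

(** At offset j the new permutation reads the old one at offset
    q^-1 (q' j), where the copy of q has height q' j. *)
Lemma copy_at_block_perm p (q q' : 'S_k) c :
  c \in S -> copy_at p q c -> copy_at (block_perm (q' * q^-1) * p) q' c.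
Proof.
move=> cS /forallP copy; apply/forallP => j.
pose x := Ordinal (corner_bound c.1 kn (ltn_ord j)).
rewrite -[c.1 + j]/(val x) one_lineE permM -one_lineE permE.
rewrite (@block_move_in _ c j) // permM (eqP (copy _)).
by rewrite permKV.
Qed.

(** Left multiplication by [block_perm] is injective; exchanging q and q' gives
    the opposite inequality. *)
Lemma leq_card_containing_copies (q q' : 'S_k) :
  #|[set p : 'S_n | S \subset copies p q]| <=
  #|[set p : 'S_n | S \subset copies p q']|.
Proof.
rewrite -(card_imset _ (mulgI (block_perm (q' * q^-1)))).
apply/subset_leq_card/subsetP => _ /imsetP[p + ->]; rewrite !inE.
move=> /subsetP sub; apply/subsetP => c cS.
by have := sub c cS; rewrite !inE; apply: copy_at_block_perm.
Qed.
End BlockPerm.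

(** * Indecomposable patterns do not overlap *)

Definition sum_split k (s : nat) (q : 'S_k) : bool :=
  [forall j : 'I_k, forall r : 'I_k, (j < s <= r) ==> (q j < q r)].

Definition skew_split k (s : nat) (q : 'S_k) : bool :=
  [forall j : 'I_k, forall r : 'I_k, (j < s <= r) ==> (q r < q j)].

Definition indecomposables k : {set 'S_k} :=
  [set q | [forall s : 'I_k, (0 < s) ==> ~~ (sum_split s q || skew_split s q)]].

(** Let the copy d start s positions after the copy c.  The entries of q from s
    on lie in both squares; the first s entries cannot take a value of the
    square of d, as those values are all used at the positions of d.  So
    they lie on one side of the common values: below if the square of d is at
    least as high as that of c, above otherwise. *)
Lemma overlap_splits n k (p : 'S_n) (q : 'S_k) (c d : corner n k) :
    k <= n -> copy_at p q c -> copy_at p q d -> c.1 < d.1 < c.1 + k ->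
  sum_split (d.1 - c.1) q || skew_split (d.1 - c.1) q.
Proof.
case: c d => [i a] [i' b] kn.
move=> /forallP /= copy_c /forallP /= copy_d /andP[lt1 lt2].
set s := i' - i.
have before (j : 'I_k) : j < s -> ~~ (b <= a + q j < b + k).
  move=> js; apply/negP => /andP[le1 le2].
  have vk : a + q j - b < k by lia.
  pose j' := (q^-1)%g (Ordinal vk).
  have e : one_line p (i + j) = one_line p (i' + j').
    rewrite (eqP (copy_c j)) (eqP (copy_d j')) permKV /=; lia.
  have := one_line_inj (corner_bound i kn (ltn_ord j))
            (corner_bound i' kn (ltn_ord j')) e.
  by move: js; rewrite /s; lia.
have after (r : 'I_k) : s <= r -> b <= a + q r < b + k.
  move=> sr; have rk : r - s < k by move: (ltn_ord r); lia.
  have := copy_d (Ordinal rk); have -> /= : i' + (r - s) = i + r.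
    by move: sr; rewrite /s; lia.
  rewrite (eqP (copy_c r)) => /eqP ->.
  by move: (ltn_ord (q (Ordinal rk))); lia.
case: (leqP a b) => ab; apply/orP; [left|right];
  apply/forallP => j; apply/forallP => r; apply/implyP => /andP[js sr];
  move: (before j js) (after r sr) (ltn_ord (q j)); lia.
Qed.

Lemma copies_disjoint n k (p : 'S_n) (q : 'S_k) :
  k <= n -> q \in indecomposables k -> disjoint_blocks (copies p q).
Proof.
move=> kn; rewrite inE => /forallP indec c d x; rewrite !inE.
wlog lecd : c d / c.1 <= d.1 => [hw | copy_c copy_d cx dx].
  case: (leqP c.1 d.1) => [|/ltnW] le_cd *; first exact: hw.
  by apply/esym; apply: hw.
move: lecd; rewrite leq_eqVlt => /orP[/eqP eqcd | ltcd].
  (* Copies with the same first position have the same value there. *)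
  have k0 : 0 < k by move: cx; rewrite /in_block; lia.
  have := forallP copy_c (Ordinal k0); have /eqP := forallP copy_d (Ordinal k0).
  rewrite -eqcd => -> /eqP/addIn e.
  case: c d eqcd e {copy_c copy_d cx dx} => [? ?] [? ?] /=.
  by move=> /val_inj -> /val_inj ->.
have lts : d.1 - c.1 < k by move: cx dx; rewrite /in_block; lia.
have /= := indec (Ordinal lts);
  rewrite subn_gt0 ltcd /= (overlap_splits kn copy_c copy_d) //.
by move: cx dx; rewrite /in_block; lia.
Qed.

(** If some permutation has copies of an indecomposable pattern at all of S,
    the blocks of S are disjoint and [leq_card_containing_copies] applies; if
    none has, the count is 0.  Either way the count for one indecomposable
    pattern is at most the count for the other. *)
Lemma V_indecomposables k n (q q' : 'S_k) :
  q \in indecomposables k -> q' \in indecomposables k -> V n q = V n q'.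
Proof.
move=> qW q'W; case: (leqP k n) => [kn | nk]; last first.
  by rewrite /V; apply: eq_card => p;
    rewrite !inE /very_tightly_avoids /very_tightly_contains leqNgt nk.
have VE (t : 'S_k) : V n t = #|[set p : 'S_n | copies p t == set0]|.
  by apply: eq_card => p; rewrite !inE very_tightly_avoidsE.
rewrite !VE; apply: superset_counts_determine => S.
have le (t t' : 'S_k) : t \in indecomposables k ->
    #|[set p : 'S_n | S \subset copies p t]| <=
    #|[set p : 'S_n | S \subset copies p t']|.
  move=> tW; case: (set_0Vmem [set p : 'S_n | S \subset copies p t]).
    by move=> ->; rewrite cards0.
  case=> p; rewrite inE => /subsetP Sp.
  apply: leq_card_containing_copies => // c d x.
  by move=> /Sp cS /Sp dS; apply: (copies_disjoint kn tW cS dS).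
by apply/eqP; rewrite eqn_leq !le.
Qed.

(** * Almost all patterns are indecomposable *)

(** A permutation preserving A is determined by its restrictions to A and to
    the complement of A. *)
Lemma card_set_stabiliser (T : finType) (A : {set T}) :
  #|('N(A | 'P))%g| <= #|A|`! * #|~: A|`!.
Proof.
pose f (q : {perm T}) := (restr_perm A q, restr_perm (~: A) q).
have injf : {in ('N(A | 'P))%g &, injective f}.
  move=> q q' qN q'N [eA eC]; apply/permP => x.
  have [xA | xA] := boolP (x \in A).
    by rewrite -(restr_permE qN xA) eA (restr_permE q'N xA).
  have NC : {subset 'N(A | 'P)%g <= 'N(~: A | 'P)%g}.
    by move=> t; rewrite astabsC.
  have xC : x \in ~: A by rewrite inE.
  by rewrite -(restr_permE (NC _ qN) xC) eC (restr_permE (NC _ q'N) xC).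
rewrite -(card_in_imset injf) -!card_perm -cardX.
apply/subset_leq_card/subsetP => _ /imsetP[q qN ->].
by apply/andP; split; apply: restr_perm_on.
Qed.

(** For j < s only positions below s can carry a value less than q j, and j
    itself does not; so q j, the rank, is less than s. *)
Lemma card_sum_split k s : s <= k ->
  #|[set q : 'S_k | sum_split s q]| <= s`! * (k - s)`!.
Proof.
move=> sk; pose A := [set j : 'I_k | j < s].
have cA : #|A| = s by apply: card_ord_lt.
have cC : #|~: A| = k - s by rewrite cardsCs setCK cA card_ord.
have := card_set_stabiliser A; rewrite cA cC; apply: leq_trans.
apply/subset_leq_card/subsetP => q; rewrite !inE => /forallP split_q.
apply/subsetP => j; rewrite inE /= => js.
rewrite !inE /= apermE -(perm_rank q) -[leqRHS]cA; apply: proper_card.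
apply/properP; split; last by exists j; rewrite !inE ?ltnn.
apply/subsetP => r; rewrite !inE; apply: contraTT; rewrite -leqNgt => sr.
have /forallP/(_ r)/implyP := split_q j.
by rewrite js sr -leqNgt => /(_ isT)/ltnW.
Qed.

(** Reversing the values turns a skew split into a sum split. *)
Lemma card_skew_split k s : s <= k ->
  #|[set q : 'S_k | skew_split s q]| <= s`! * (k - s)`!.
Proof.
move=> sk; apply: leq_trans (card_sum_split sk).
rewrite -(card_imset _ (mulIg (perm (@rev_ord_inj k)))).
apply/subset_leq_card/subsetP => _ /imsetP[q + ->].
rewrite !inE => /forallP split_q.
apply/forallP => j; apply/forallP => r; have /forallP/(_ r) := split_q j.
move=> /implyP skew; apply/implyP => /skew; rewrite !permM !permE /=.
move=> lt; apply: ltn_sub2l; last by rewrite ltnS.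
exact: leq_ltn_trans lt (ltn_ord (q j)).
Qed.

Lemma leq_fact2 a b : 1 < a -> 1 < b -> a`! * b`! <= 2 * (a + b - 2)`!.
Proof.
move=> a1 b1; elim: a a1 => // a IHa; rewrite ltnS leq_eqVlt => /orP[/eqP<-|a1].
  by rewrite addKn.
rewrite factS -mulnA.
have -> : a.+1 + b - 2 = (a + b - 2).+1 by lia.
rewrite factS [leqRHS]mulnCA; apply: leq_mul; [lia | exact: IHa].
Qed.

(** The two extreme terms are (k + 2)! each; by [leq_fact2] each of the k others
    is at most 2 (k + 1)!. *)
Lemma sum_fact_split k :
  \sum_(1 <= s < k.+3) s`! * (k.+3 - s)`! <= 4 * (k.+2)`!.
Proof.
rewrite big_nat_recr //= big_ltn // subSS subn0 subSnn mul1n muln1.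
have : \sum_(2 <= s < k.+2) s`! * (k.+3 - s)`! <= 2 * (k.+2)`!.
  apply: (@leq_trans (\sum_(2 <= s < k.+2) 2 * (k.+1)`!)).
    rewrite big_nat [leqRHS]big_nat; apply: leq_sum => s /andP[s2 sk].
    have {2}-> : k.+1 = s + (k.+3 - s) - 2 by lia.
    by apply: leq_fact2; lia.
  rewrite sum_nat_const_nat [in leqRHS]factS mulnCA leq_mul2l leq_mul2r.
  by apply/orP; right; apply/orP; right; lia.
lia.
Qed.

Lemma card_indecomposables k :
  (k.+3)`! <= #|indecomposables k.+3| + 8 * (k.+2)`!.
Proof.
rewrite -card_Sn -(cardsC (indecomposables k.+3)) leq_add2l.
pose B s := [set q : 'S_k.+3 | sum_split s q] :|: [set q | skew_split s q].
have sub : ~: indecomposables k.+3 \subset \bigcup_(s < k.+3 | 0 < s) B s.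
  apply/subsetP => q; rewrite !inE negb_forall => /existsP[s].
  rewrite negb_imply negbK => /andP[s0 split_s].
  by apply/bigcupP; exists s; rewrite // !inE.
apply: leq_trans (subset_leq_card sub) _.
apply: (@leq_trans (\sum_(s < k.+3 | 0 < s) 2 * (s`! * (k.+3 - s)`!))).
  elim/big_rec2: _ => [|s m U _ leU]; first by rewrite cards0.
  apply: leq_trans (leq_card_setU _ _) _; apply: leq_add leU.
  apply: leq_trans (leq_card_setU _ _) _; rewrite mul2n -addnn.
  by rewrite leq_add ?card_sum_split ?card_skew_split // ltnW.
rewrite -big_distrr /=.
rewrite -(big_mkord (fun s => 0 < s) (fun s => s`! * (k.+3 - s)`!)).
rewrite big_ltn_cond //=.
rewrite -[8]/(2 * 4) -mulnA leq_mul2l /=; apply: leq_trans (sum_fact_split k).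
by rewrite big_nat_cond [leqRHS]big_nat; apply/eq_leq/eq_bigl => s; lia.
Qed.

(** * The density of the indecomposable patterns *)

From mathcomp Require Import all_classical all_reals all_analysis.

Import Order.TTheory GRing.Theory Num.Theory.
Import numFieldNormedType.Exports.

Local Open Scope classical_set_scope.
Local Open Scope ring_scope.

Lemma indecomposables_density (R : realType) (k : nat) :
  1 - 8 * (k.+3%:R)^-1 <= #|indecomposables k.+3|%:R / (k.+3`!)%:R :> R.
Proof.
have f0 : 0 < (k.+3`!)%:R :> R by rewrite ltr0n fact_gt0.
rewrite ler_pdivlMr // mulrBl mul1r lerBlDr -mulrA.
rewrite factS natrM mulKf ?pnatr_eq0 // -!natrM -natrD ler_nat -factS.
exact: card_indecomposables.
Qed.

Theorem mainTheorem2 (R : realType) :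
  exists W : forall k : nat, {set 'S_k},
    ((fun k : nat => #|W k|%:R / (k`!)%:R : R) @ \oo --> (1 : R)) /\
    (forall k n : nat, (0 < k)%N -> (0 < n)%N ->
      forall q q' : 'S_k, q \in W k -> q' \in W k -> V n q = V n q').
Proof.
exists indecomposables; split; last first.
  by move=> k n _ _ q q'; apply: V_indecomposables.
(* The density bound is for patterns of length at least 3. *)
rewrite -3!cvg_shiftS /=.
apply: (@squeeze_cvgr _ _ _ _ (fun k => 1 - 8 * (k.+3%:R)^-1) (fun=> 1)).
- apply: nearW => k; rewrite indecomposables_density /=.
  rewrite ler_pdivrMr ?ltr0n ?fact_gt0 // mul1r ler_nat -card_Sn.
  exact: max_card.
- rewrite -[X in _ --> X]subr0 -[X in _ --> _ - X](mulr0 8).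
  apply: cvgB; first exact: cvg_cst.
  apply: cvgM; first exact: cvg_cst.
  have := @cvg_harmonic R; rewrite -cvg_shiftS -cvg_shiftS; exact.
- exact: cvg_cst.
Qed.
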